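(* Let $X$ be a random variable with values in $\mathbb{N}_0$ and let $\lambda\in(0,\infty)$. Let $Z$ be a random variable defined on the same probability space as $X$ with values in $\mathbb{Z}$, and let $(q_i)_{i\in\mathbb{N}_0}$ be the sequence given by $$ q_{i-1}=i\,\mathbb{P}(X=i)-\lambda\,\mathbb{P}(X+Z=i-1),\qquad i\in\mathbb{N}. $$ (a) If $Z$ is non-negative and $q_i\le 0$ for all $i\in\mathbb{N}_0$, then $\mathbb{P}(X=0)\ge e^{-\lambda}$. (b) If $Z$ is non-positive, $\mathbb{P}(X+Z\ge 0)=1$ and $q_i\ge 0$ for all $i\in\mathbb{N}_0$, then $\mathbb{P}(X=0)\le e^{-\lambda}$.
   Context: $\mathbb{N}=\{1,2,\dots\}$ and $\mathbb{N}_0=\mathbb{N}\cup\{0\}$. *)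

(* Defs.v *)
From HB Require Import structures.
From mathcomp Require Import all_boot all_order all_algebra.
From mathcomp Require Import all_classical all_reals all_analysis.

Set Implicit Arguments.
Unset Strict Implicit.
Unset Printing Implicit Defensive.

(* [int] with the discrete sigma-algebra, as the library does for [nat]; it
   makes [{RV P >-> int}] the type of integer-valued random variables. The
   point 0 is required by the [measurableType] interface only. *)
HB.instance Definition _ := isPointed.Build int 0%Z.
HB.instance Definition _ := @isMeasurable.Build default_measure_display
  int (@discrete_measurable int) (@discrete_measurable0 int)
  (@discrete_measurableC int) (@discrete_measurableU int).

(* Main.v *)
Require Import Defs.
From mathcomp Require Import all_boot all_order all_algebra.
From mathcomp Require Import all_classical all_reals all_analysis.
From mathcomp Require Import ring lra zify.

Set Implicit Arguments.
Unset Strict Implicit.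
Unset Printing Implicit Defensive.

Import Order.TTheory GRing.Theory Num.Theory.
Import numFieldNormedType.Exports.

Local Open Scope classical_set_scope.
Local Open Scope ring_scope.

(** Let [p i = P (X = i)] and [r i = P (X + Z = i)]. The sign of [q] compares
    [i.+1 * p i.+1] with [lambda * r i]; these are coefficients of the
    derivative of the generating function [G s = E (s ^ X)] and of
    [lambda * E (s ^ (X + Z))]. When [Z >= 0] one has
    [E (s ^ (X + Z)) <= G s] for [s] in [[0, 1]], so that [q <= 0] yields
    [G' <= lambda * G]: then [exp (- lambda * s) * G s] is nonincreasing, and
    comparing its values at 0 and 1 gives [exp (- lambda) <= G 0 = P (X = 0)].
    Part (b) is the same argument with every inequality reversed; there
    [X + Z >= 0] almost surely is what makes [E (s ^ (X + Z)) >= G s], since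
    the numbers [r i] then account for the whole mass of [X + Z].

    [G] need not be differentiable at 1, so the proof works with the
    truncations of [G] at degree [n], which are polynomials, and lets [n] tend
    to infinity only at the end. The comparison of the two generating functions
    survives truncation because it follows from a comparison of partial sums,
    i.e. of distribution functions ([ler_sum_exprn]): [Z >= 0] makes
    [P (X + Z < k) <= P (X < k)]. In part (a) the truncation costs nothing
    ([expR_sum_le_head]). In part (b) the derivative of the truncation at degree
    [n] is only controlled by the truncation at degree [n - 1], which costs
    an error [lambda * p n], tending to 0 ([head_le_expR_sum]). *)

(** * A differential inequality for polynomials *)

(** Gronwall's inequality on [[0, 1]]: the derivative of
    [exp (- lambda * s) * f s - c * s] is at most
    [c * (exp (- lambda * s) - 1) <= 0]. *)
Lemma expR_derive_bound (R : realType) (f : {poly R}) (lambda c : R) :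
  0 <= lambda -> 0 <= c ->
  (forall s, 0 <= s <= 1 -> f^`().[s] <= lambda * f.[s] + c) ->
  expR (- lambda) * f.[1] <= f.[0] + c.
Proof.
move=> lambda_ge0 c_ge0 f'_le.
pose g (s : R) : R := expR (s * - lambda) * f.[s] - c * s.
have dg (s : R) : is_derive s 1 g
    (expR (s * - lambda) * (f^`().[s] - lambda * f.[s]) - c).
  by apply: is_derive_eq; rewrite /GRing.scale/=; ring.
have cg : {within `[0, 1], continuous g}.
  by apply: derivable_within_continuous => s _; exact: ex_derive.
have [s s01 gE] := MVT ltr01 (fun s _ => dg s) cg.
have : g 1 - g 0 <= 0.
  rewrite gE subr0 mulr1 subr_le0.
  move: s01; rewrite in_itv /= => /andP[/ltW s0 /ltW s1].
  have /f'_le le_s : 0 <= s <= 1 by rewrite s0 s1.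
  apply: (@le_trans _ _ (expR (s * - lambda) * c)).
    by rewrite ler_wpM2l ?expR_ge0// lerBlDl.
  by rewrite ler_piMl// -expR0 ler_expR mulrN oppr_le0 mulr_ge0.
by rewrite /g mul0r expR0 !mul1r mulr1 mulr0 subr0 subr_le0 lerBlDr.
Qed.

(** * Truncated generating functions *)

Lemma deriv_poly (R : nzRingType) (a : nat -> R) (n : nat) :
  (\poly_(i < n.+1) a i)^`() = \poly_(i < n) (a i.+1 *+ i.+1).
Proof.
apply/polyP => i; rewrite coef_deriv !coef_poly ltnS.
by case: ifP => //; rewrite mul0rn.
Qed.

Lemma horner_poly_0 (R : nzRingType) (a : nat -> R) (n : nat) :
  (\poly_(i < n.+1) a i).[0] = a 0.
Proof. by rewrite horner_coef0 coef_poly. Qed.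

Lemma horner_poly_1 (R : nzRingType) (a : nat -> R) (n : nat) :
  (\poly_(i < n) a i).[1] = \sum_(i < n) a i.
Proof. by rewrite horner_poly; apply: eq_bigr => i _; rewrite expr1n mulr1. Qed.

(** Stochastic domination, tested against the nonincreasing function
    [i |-> s ^+ i]. *)
Lemma ler_sum_exprn (R : numDomainType) (a b : nat -> R) (s : R) (n : nat) :
  0 <= s <= 1 -> (forall k, \sum_(i < k) a i <= \sum_(i < k) b i) ->
  \sum_(i < n) a i * s ^+ i <= \sum_(i < n) b i * s ^+ i.
Proof.
move=> /andP[s0 s1] le_ab; pose D k := \sum_(i < k) (b i - a i).
have D_ge0 k : 0 <= D k by rewrite /D sumrB subr_ge0.
rewrite -subr_ge0 -sumrB; under eq_bigr do rewrite -mulrBl.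
(* This bound, unlike nonnegativity alone, is inductive: the new term
   completes [D n] to [D n.+1], after which one more factor [s] can be lost. *)
suff : s ^+ n * D n <= \sum_(i < n) (b i - a i) * s ^+ i.
  by apply: le_trans; rewrite mulr_ge0 ?exprn_ge0.
elim: n => [|n IH]; first by rewrite /D !big_ord0 mulr0.
apply: (@le_trans _ _ (s ^+ n * D n.+1)).
  by rewrite ler_wpM2r// exprS ler_piMl ?exprn_ge0.
by rewrite /D !big_ord_recr/= mulrDr (mulrC (s ^+ n) (b n - a n)) lerD2r.
Qed.

(** The truncation [f] of the generating function of [p] at degree [n] satisfies
    [f' <= lambda * f]: the dropped term [p n * s ^+ n] has the right sign. *)
Lemma expR_sum_le_head (R : realType) (p r : nat -> R) (lambda : R) (n : nat) :
  0 <= lambda -> (forall i, 0 <= p i) ->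
  (forall i, p i.+1 *+ i.+1 <= lambda * r i) ->
  (forall k, \sum_(i < k) r i <= \sum_(i < k) p i) ->
  expR (- lambda) * \sum_(i < n.+1) p i <= p 0.
Proof.
move=> lambda_ge0 p_ge0 p_le r_le.
rewrite -horner_poly_1 -(horner_poly_0 p n) -[leRHS]addr0.
apply: expR_derive_bound => // s s01; have /andP[s0 s1] := s01.
rewrite deriv_poly !horner_poly addr0.
apply: (@le_trans _ _ (lambda * \sum_(i < n) r i * s ^+ i)).
  rewrite mulr_sumr; apply: ler_sum => i _.
  by rewrite mulrA ler_wpM2r ?exprn_ge0.
rewrite ler_wpM2l// big_ord_recr/= (le_trans (ler_sum_exprn n s01 r_le))//.
by rewrite lerDl mulr_ge0 ?exprn_ge0.
Qed.

(** The truncation [f] at degree [n] satisfies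
    [f' >= lambda * (f - p n * s ^+ n) >= lambda * f - lambda * p n], so the
    differential inequality holds for [- f] with error [lambda * p n]. *)
Lemma head_le_expR_sum (R : realType) (p r : nat -> R) (lambda : R) (n : nat) :
  0 <= lambda -> (forall i, 0 <= p i) ->
  (forall i, lambda * r i <= p i.+1 *+ i.+1) ->
  (forall k, \sum_(i < k) p i <= \sum_(i < k) r i) ->
  p 0 <= expR (- lambda) * \sum_(i < n.+1) p i + lambda * p n.
Proof.
move=> lambda_ge0 p_ge0 p_ge r_ge.
suff : expR (- lambda) * (- \poly_(i < n.+1) p i).[1] <=
    (- \poly_(i < n.+1) p i).[0] + lambda * p n.
  by rewrite !hornerN horner_poly_0 horner_poly_1; lra.
apply: expR_derive_bound => //; first by rewrite mulr_ge0.
move=> s s01; have /andP[s0 s1] := s01.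
rewrite derivN !hornerN deriv_poly !horner_poly mulrN lerNl opprD opprK.
apply: (@le_trans _ _ (lambda * \sum_(i < n) r i * s ^+ i)); last first.
  rewrite mulr_sumr; apply: ler_sum => i _.
  by rewrite mulrA ler_wpM2r ?exprn_ge0.
rewrite -mulrBr ler_wpM2l// big_ord_recr/=.
apply: le_trans (ler_sum_exprn n s01 r_ge).
by rewrite -addrA gerDl subr_le0 ler_piMr// exprn_ile1.
Qed.

(** * Measures of level sets *)

Lemma le_measure_ae d (T : measurableType d) (R : realType)
    (mu : {measure set T -> \bar R}) (A B : set T) :
  measurable A -> measurable B -> {ae mu, forall t, A t -> B t} ->
  (mu A <= mu B)%E.
Proof.
move=> mA mB [N [mN N0 subN]].
have AB : A `<=` B `|` N.
  move=> t At; have [Bt|nBt] := pselect (B t); first by left.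
  by right; apply: subN => /(_ At).
apply: (@le_trans _ _ (mu (B `|` N))).
  by apply: le_measure => //; rewrite inE//; exact: measurableU.
by rewrite (le_trans (measureU2 mu mB mN))// -[leRHS]adde0 -N0.
Qed.

Lemma ae_probability1 d (T : measurableType d) (R : realType)
    (P : probability T R) (A : set T) :
  measurable A -> P A = 1%E -> {ae P, forall t, A t}.
Proof.
move=> mA PA1; exists (~` A); split => //; first exact: measurableC.
by rewrite probability_setC// PA1 subee.
Qed.

(** Measurability for the product sigma-algebra is replaced by a countable union
    over the values of the first variable. *)
Lemma measurable_joint_nat_int d (T : measurableType d)
    (X : {mfun T >-> nat}) (Z : {mfun T >-> int}) (Q : nat -> int -> Prop) :
  measurable [set t | Q (X t) (Z t)].
Proof.
rewrite (_ : mkset _ =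
    \bigcup_n (X @^-1` [set n] `&` Z @^-1` [set z | Q n z])); last first.
  apply/seteqP; split => [t Qt|t [n _ [/= <-]]//].
  by exists (X t).
by apply: bigcup_measurable => n _; apply: measurableI; exact: measurable_funPTI.
Qed.

(** By additivity both sides are probabilities of finite unions, and the
    almost sure hypothesis is an inclusion between these unions. *)
Lemma le_sum_fine_measure d (T : measurableType d) (R : realType)
    (P : probability T R) (A B : nat -> set T) (k : nat) :
  (forall i, measurable (A i)) -> (forall i, measurable (B i)) ->
  trivIset setT A -> trivIset setT B ->
  {ae P, forall t, forall i, (i < k)%N -> A i t -> exists2 j, (j < k)%N & B j t} ->
  \sum_(i < k) fine (P (A i)) <= \sum_(i < k) fine (P (B i)).
Proof.
move=> mA mB tA tB AB.
have fineP (F : nat -> set T) : (forall i, measurable (F i)) ->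
    trivIset setT F ->
    (\sum_(i < k) fine (P (F i)))%:E = P (\bigcup_(i in `I_k) F i).
  move=> mF tF; rewrite bigcup_mkord measure_bigsetU// -sumEFin.
  by apply: eq_bigr => i _; rewrite fineK// fin_num_measure.
rewrite -lee_fin !fineP//; apply: le_measure_ae.
- exact: bigcup_measurable.
- exact: bigcup_measurable.
- apply: filterS AB => t AB [i /= ik Ait].
  by have [j jk Bjt] := AB i ik Ait; exists j.
Qed.

Lemma cvg_sum_fine_measure d (T : measurableType d) (R : realType)
    (P : probability T R) (A : nat -> set T) :
  (forall i, measurable (A i)) -> trivIset setT A -> \bigcup_i A i = setT ->
  (\sum_(i < n) fine (P (A i))) @[n --> \oo] --> (1 : R).
Proof.
move=> mA tA AT.
have : (\sum_(0 <= i < n) P (A i))%E @[n --> \oo] --> 1%E.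
  have -> : 1%E = P (\bigcup_i A i) by rewrite AT probability_setT.
  exact: (measure_sigma_additive mA tA).
move=> /fine_cvg; apply: cvg_trans; apply: near_eq_cvg; near=> n => /=.
rewrite big_mkord (eq_bigr (fun i : 'I_n => (fine (P (A i)))%:E)) ?sumEFin//.
by move=> i _; rewrite fineK// fin_num_measure.
Unshelve. all: by end_near. Qed.

(** * The comparison with the Poisson probability of zero *)

Theorem proposition2p6 (d : measure_display) (T : measurableType d)
    (R : realType) (P : probability T R)
    (X : {RV P >-> nat}) (lambda : R) (lambda_gt0 : 0 < lambda)
    (Z : {RV P >-> int}) (q : nat -> R)
    (qE : forall i : nat, (1 <= i)%N ->
       ((q i.-1)%:E = i%:R%:E * P [set t | X t = i]
          - lambda%:E * P [set t | ((X t)%:Z + Z t = i%:Z - 1)%R])%E) :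
  ({ae P, forall t, 0 <= Z t} ->
   (forall i : nat, q i <= 0) ->
   ((expR (- lambda))%:E <= P [set t | X t = 0%N])%E)
  /\
  ({ae P, forall t, Z t <= 0} ->
   P [set t | 0 <= (X t)%:Z + Z t] = 1%E ->
   (forall i : nat, 0 <= q i) ->
   (P [set t | X t = 0%N] <= (expR (- lambda))%:E)%E).
Proof.
pose A i := [set t | X t = i].
pose B i := [set t | (X t)%:Z + Z t = i%:Z].
pose p i := fine (P (A i)); pose r i := fine (P (B i)).
have mA i : measurable (A i) by exact: (measurable_funPTI X (Y := [set i])).
have mB i : measurable (B i).
  exact: (measurable_joint_nat_int X Z (fun n z => n%:Z + z = i%:Z)).
have tA : trivIset setT A by move=> i j _ _ [t [/= <- <-]].
have tB : trivIset setT B by move=> i j _ _ [t []]; rewrite /B/= => -> [].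
have AE i : P (A i) = (p i)%:E by rewrite fineK// fin_num_measure.
have BE i : P (B i) = (r i)%:E by rewrite fineK// fin_num_measure.
have p_ge0 i : 0 <= p i by rewrite fine_ge0.
have qpr i : q i = p i.+1 *+ i.+1 - lambda * r i.
  have := qE i.+1 isT; rewrite -/(A _).
  have -> : [set t | (X t)%:Z + Z t = i.+1%:Z - 1] = B i.
    by rewrite -addn1 PoszD addrK.
  by rewrite AE BE -!EFinM -EFinB => -[->]; rewrite mulr_natl.
have cvgS : (\sum_(i < n.+1) p i) @[n --> \oo] --> (1 : R).
  rewrite (cvg_shiftS (fun n => \sum_(i < n) p i)).
  apply: cvg_sum_fine_measure => //.
  by apply/seteqP; split => // t _; exists (X t).
have cvgeS :
    (expR (- lambda) * \sum_(i < n.+1) p i) @[n --> \oo] --> expR (- lambda).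
  by rewrite -[X in _ --> X]mulr1; exact: cvgMr.
rewrite -/(A 0%N) AE !lee_fin; split => [Z_ge0 q_le0|Z_le0 XZ1 q_ge0].
- apply: cvgr_to_le cvgeS _; near=> n.
  apply: (@expR_sum_le_head _ p r) => // [|i|k]; first exact: ltW.
    by rewrite -subr_le0 -qpr.
  apply: le_sum_fine_measure => //; apply: filterS Z_ge0 => t Zt i ik Bi.
  by exists (X t) => //; move: Bi Zt ik; rewrite /B/=; lia.
- have XZ_ge0 : {ae P, forall t, 0 <= (X t)%:Z + Z t}.
    apply: ae_probability1 XZ1.
    exact: (measurable_joint_nat_int X Z (fun n z => 0 <= n%:Z + z)).
  have cvgp : p n @[n --> \oo] --> (0 : R).
    have : cvgn (series p).
      apply/cvg_ex; exists 1; rewrite -cvg_shiftS.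
      by under eq_fun do rewrite /series/= big_mkord.
    exact: cvg_series_cvg_0.
  have cvg_bound : (expR (- lambda) * (\sum_(i < n.+1) p i) + lambda * p n)
      @[n --> \oo] --> expR (- lambda).
    rewrite -[X in _ --> X]addr0 -[X in _ --> _ + X](mulr0 lambda).
    by apply: cvgD => //; exact: cvgMr.
  apply: cvgr_to_ge cvg_bound _; near=> n.
  apply: (@head_le_expR_sum _ p r) => // [|i|k]; first exact: ltW.
    by rewrite -subr_ge0 -qpr.
  apply: le_sum_fine_measure => //.
  apply: filterS2 Z_le0 XZ_ge0 => t Zt XZt i ik Ai.
  exists `|((X t)%:Z + Z t)%R|%N; last by rewrite /B/= gez0_abs.
  by move: Ai Zt XZt ik; rewrite /A/=; lia.
Unshelve. all: by end_near. Qed.
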